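(* Let $(\Omega,\mathcal A,\mu)$ be a $\sigma$-finite measure space and $K\in(0,\mu(\Omega))$. Then $$\{s\in L^\infty(\Omega)\mid\|s\|_\infty\le1,\ \|s\|_0\le K\}\subseteq\partial|\cdot|_K(0)\subseteq\{s\in L^\infty(\Omega)\mid\|s\|_\infty\le1,\ \|s\|_1\le K\}.$$
   Context: The largest-$K$-norm is $|u|_K:=\sup_{A\in\mathcal A:\ \mu(A)\le K}\int_A|u|\,d\mu$ for $u\in L^1(\Omega)$, and $\|s\|_0:=\mu(\{x\in\Omega\mid s(x)\ne0\})$. The convex subdifferential at $0$ is taken in $L^1(\Omega)$, with $L^1(\Omega)'$ identified with $L^\infty(\Omega)$: $\partial|\cdot|_K(0)=\{s\in L^\infty(\Omega)\mid |v|_K\ge\int_\Omega s\,v\,d\mu\ \ \forall v\in L^1(\Omega)\}$. *)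

(* Defs.v *)
From HB Require Import structures.
From mathcomp Require Import all_boot all_order all_algebra.
From mathcomp Require Import all_classical all_reals all_analysis.

Set Implicit Arguments.
Unset Strict Implicit.
Unset Printing Implicit Defensive.

Import Order.TTheory GRing.Theory Num.Theory.
Import numFieldNormedType.Exports.

Local Open Scope classical_set_scope.
Local Open Scope ring_scope.
Local Open Scope ereal_scope.

Section largest_K_norm.
Context d (T : measurableType d) (R : realType).
Variable mu : {measure set T -> \bar R}.

(* The elements of L1 and Linfty are classes of measurable functions modulo
   equality mu-almost everywhere; such a class is applied to a point through
   its chosen representative. Every quantity below depends only on the class. *)
Definition L1 := LspaceType1 mu.
Definition Linfty := LspaceType mu (leey (1 : \bar R)).

Definition largest_K_norm (K : R) (u : T -> R) : \bar R :=
  ereal_sup [set \int[mu]_(x in A) `|u x|%:E |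
             A in [set A : set T | measurable A /\ mu A <= K%:E]].

Definition L0_norm (s : T -> R) : \bar R := mu [set x | s x != 0%R].

(* The dual of L1 is identified with Linfty through the pairing
   (s, v) |-> \int s v; as largest_K_norm vanishes at 0, the subgradient
   inequality at 0 has no constant term. *)
Definition largest_K_subdifferential0 (K : R) : set Linfty :=
  [set s | forall v : L1,
    \int[mu]_x (s x * v x)%:E <= largest_K_norm K v].

End largest_K_norm.

Arguments largest_K_subdifferential0 {d T R} mu K.

(* Main.v *)
(** Testing the subgradient inequality against [v = sgn(s) 1_B] with [B] of
    finite measure gives [\int_B |s| <= |1_B|_K <= min(mu B, K)].  Exhausting the
    space by sets of finite measure, the bound [K] yields [|s|_1 <= K], and the
    bound [mu B] on [B = {|s| > 1}] yields [|s| <= 1] almost everywhere.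
    Conversely, if [|s| <= 1] then [\int s v <= \int_{s != 0} |v|], and the
    support of [s] is one of the sets over which [|v|_K] is a supremum. *)
Require Import Defs.
From HB Require Import structures.
From mathcomp Require Import all_boot all_order all_algebra.
From mathcomp Require Import all_classical all_reals all_analysis.
From mathcomp Require Import measurable_realfun ess_sup_inf.
Import Order.TTheory GRing.Theory Num.Theory.
Import numFieldNormedType.Exports.
Local Open Scope classical_set_scope.
Local Open Scope ring_scope.
Local Open Scope ereal_scope.

Lemma measurable_aeEqMfun {d : measure_display} {T : measurableType d}
    {R : realType} {mu : {measure set T -> \bar R}}
    (f : {mfun_ mu, T >-> measurableTypeR R}) :
  measurable_fun [set: T] (f : T -> R).
Proof. exact: (measurable_funPT (repr f)). Qed.

(** The subgradient inequality quantifies over classes, so a concrete test function has to be lifted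
    to [L1]. The class of [f] is packed with the finiteness of its norm; its chosen representative
    is known to agree with [f] only almost everywhere. *)
Lemma L1_of_integrable {d : measure_display} {T : measurableType d}
    {R : realType} {mu : {measure set T -> \bar R}} {f : T -> R} :
  mu.-integrable [set: T] (EFin \o f) ->
  exists v : L1 mu, \forall x \ae mu, v x = f x.
Proof.
move=> /integrableP[/measurable_EFinP mf fy].
pose g : {mfun T >-> measurableTypeR R} :=
  MeasurableFun.Pack (MeasurableFun.Class
    (isMeasurableFun.Build _ _ T (measurableTypeR R) f mf)).
pose w : {mfun_ mu, T >-> measurableTypeR R} := (\pi g)%qT.
have wf : \forall x \ae mu, w x = f x.
  have /asboolP : ae_eq_op mu (repr w) g by apply/eqmodP; rewrite reprK.
  by apply: filterS => x /(_ I).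
have wfin : finite_norm mu 1 w.
  rewrite /finite_norm Lnorm1 (ge0_ae_eq_integral (g := fun x => `|(f x)%:E|))//.
  - apply: measurableT_comp => //; apply/measurable_EFinP.
    exact: measurable_aeEqMfun.
  - by apply: measurableT_comp => //; apply/measurable_EFinP.
  - by apply: filterS wf => x /= -> _.
pose c := isFinLebesgue.Build d T R mu 1 (lexx 1) w wfin.
by exists (LebesgueSpace.Pack (LebesgueSpace.Class c)).
Qed.

Section subgradient.
Context {d : measure_display} {T : measurableType d} {R : realType}.
Context {mu : {measure set T -> \bar R}} {K : R}.

(** Over an admissible [A] the integral of [|u|] is [mu (B]&[A)], which is at most [mu B] and at
    most [mu A <= K]; both bounds pass to the supremum. *)
Lemma largest_K_norm_ae_indic {B : set T} {u : T -> R} :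
  measurable B -> measurable_fun [set: T] u ->
  (\forall x \ae mu, `|u x|%R = \1_B x) ->
  largest_K_norm mu K u <= mu B /\ largest_K_norm mu K u <= K%:E.
Proof.
move=> mB mu_u uB.
have muAB A : measurable A -> \int[mu]_(x in A) `|u x|%:E = mu (B `&` A).
  move=> mA; rewrite -integral_indic//; apply: ge0_ae_eq_integral => //.
  - apply/measurable_EFinP; apply: measurableT_comp => //.
    exact: measurable_funS mu_u.
  - by apply/measurable_EFinP; exact: measurable_indic.
  - by apply: filterS uB => x -> _.
split; apply: ub_ereal_sup => _ [A [mA muAK] <-]; rewrite muAB//.
  by apply: le_measure; rewrite ?inE//; exact: measurableI.
apply: le_trans muAK.
by apply: le_measure; rewrite ?inE//; exact: measurableI.
Qed.

Lemma subdifferential0_integral_le {s : Linfty mu} {B : set T} :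
  largest_K_subdifferential0 mu K s -> measurable B -> mu B < +oo ->
  \int[mu]_(x in B) `|s x|%:E <= mu B /\
  \int[mu]_(x in B) `|s x|%:E <= K%:E.
Proof.
move=> sK mB muBy; have ms := measurable_aeEqMfun s.
pose P := [set x | (0 <= s x)%R].
have mP : measurable P.
  rewrite (_ : P = s @^-1` `[0%R, +oo[); last first.
    by apply/seteqP; split=> x; rewrite /P/= in_itv/= andbT.
  by rewrite -[_ @^-1` _]setTI; exact: ms.
(* The sign is taken to be 1 where [s] vanishes, so that [|f|] is exactly the indicator of [B] while
   [s * f] is still [|s|] on [B]. Finiteness of [mu B] then makes [f] integrable. *)
pose f : T -> R := (\1_(B `&` P) - \1_(B `\` P))%R.
have mf : measurable_fun [set: T] f.
  apply: measurable_funB; apply: measurable_indic.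
    exact: measurableI.
  exact: measurableD.
have normf x : `|f x|%R = \1_B x.
  rewrite /f !fctE !indicE in_setI in_setD.
  by case: (x \in B); case: (x \in P); rewrite /= ?subr0 ?sub0r ?normrN ?normr1 ?normr0.
have sf x : (s x * f x = `|s x| * \1_B x)%R.
  rewrite /f !fctE !indicE in_setI in_setD.
  have [sx|sx] := leP 0%R (s x).
    by rewrite (mem_set (sx : P x)) andbT andbF subr0 ger0_norm.
  have NPx : ~ P x by rewrite /P/= leNgt sx.
  rewrite (memNset NPx) andbT andbF sub0r ltr0_norm//.
  by rewrite mulrN mulNr.
have fi : mu.-integrable [set: T] (EFin \o f).
  apply/integrableP; split; first exact/measurable_EFinP.
  under eq_integral do rewrite /= normf.
  by rewrite integral_indic// setIT.
have [v vf] := L1_of_integrable fi.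
have vB : \forall x \ae mu, `|v x|%R = \1_B x.
  by apply: filterS vf => x ->.
have mv := measurable_aeEqMfun v.
have sv : \int[mu]_x (s x * v x)%:E = \int[mu]_(x in B) `|s x|%:E.
  rewrite [RHS]integral_mkcond (ae_eq_integral ((fun x => `|s x|%:E) \_ B))//.
  - by apply/measurable_EFinP; exact: measurable_funM.
  - apply/(measurable_restrictT _ _).1 => //; apply/measurable_EFinP.
    apply: measurableT_comp => //.
    exact: measurable_funS ms.
  - apply: filterS vf => x -> _; rewrite sf patchE indicE.
    by case: ifPn; rewrite ?mulr1 ?mulr0.
have [nB nK] := largest_K_norm_ae_indic mB mv vB.
by rewrite -sv; split; [exact: le_trans nB|exact: le_trans nK].
Qed.

End subgradient.

(** On the part [B] of [{f > 1}] inside one set [F n] of finite measure, [f - 1] is positive but its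
    integral is at most 0. So [B] is null, and countably many [F n] cover the space. *)
Lemma ae_le1_of_integral_le {d : measure_display} {T : measurableType d}
    {R : realType} {mu : {measure set T -> \bar R}} {f : T -> R} :
  sigma_finite [set: T] mu -> measurable_fun [set: T] f ->
  (forall B, measurable B -> mu B < +oo ->
    \int[mu]_(x in B) (f x)%:E <= mu B) ->
  \forall x \ae mu, (f x <= 1)%R.
Proof.
move=> /sigma_finiteP[F [TF _ Ffin]] mf fB.
pose G := [set x | (1 < f x)%R].
have mG : measurable G.
  rewrite (_ : G = f @^-1` `]1%R, +oo[); last first.
    by apply/seteqP; split=> x; rewrite /G/= in_itv/= andbT.
  by rewrite -[_ @^-1` _]setTI; exact: mf.
suff H n : \forall x \ae mu, F n x -> (f x <= 1)%R.
  apply: filterS (ae_foralln H) => x xF.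
  have [n _ Fnx] : (\bigcup_i F i) x by rewrite -TF.
  exact: xF Fnx.
have [mFn Fny] := Ffin n.
pose B := F n `&` G.
have mB : measurable B by exact: measurableI.
have mBy : mu B < +oo.
  by apply: le_lt_trans Fny; apply: le_measure; rewrite ?inE//; exact: subIsetl.
have mh : measurable_fun B (fun x => (f x - 1)%:E).
  apply/measurable_EFinP/measurable_funB => //.
  exact: measurable_funS mf.
have h0 x : B x -> 0 <= (f x - 1)%:E.
  by move=> [_ /ltW]; rewrite lee_fin subr_ge0.
have := fB _ mB mBy.
(* Both summands are nonnegative on [B], so the integral splits without integrability of [f]; the
   finite [mu B] then cancels from both sides. *)
rewrite (eq_integral (fun x => cst 1 x + (f x - 1)%:E)); last first.
  by move=> x _; rewrite /= -EFinD addrC subrK.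
have mBfin : mu B \is a fin_num by rewrite ge0_fin_numE.
rewrite ge0_integralD// integral_cst// mul1e addeC -leeBrDr// subee// => h.
have /(ae_eq_integral_abs mu mB mh) : \int[mu]_(x in B) `|(f x - 1)%:E| = 0.
  under eq_integral => x xB do rewrite (gee0_abs (h0 _ (set_mem xB))).
  by apply/eqP; rewrite eq_le h integral_ge0.
apply: filterS => x /= fx1 Fx; rewrite leNgt; apply/negP => f1x.
have [/eqP] := fx1 (conj Fx f1x).
by rewrite subr_eq0 gt_eqF.
Qed.

(** Monotone convergence along a nondecreasing exhaustion [F n] by sets of finite measure. *)
Lemma integral_le_of_sigma_finite {d : measure_display} {T : measurableType d}
    {R : realType} {mu : {measure set T -> \bar R}} {f : T -> \bar R}
    {c : \bar R} :
  sigma_finite [set: T] mu -> measurable_fun [set: T] f ->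
  (forall x, 0 <= f x) ->
  (forall B, measurable B -> mu B < +oo -> \int[mu]_(x in B) f x <= c) ->
  \int[mu]_x f x <= c.
Proof.
move=> /sigma_finiteP[F [TF ndF Ffin]] mf f0 fB.
have fF n : \int[mu]_x (f \_ (F n)) x <= c.
  by have [mFn Fny] := Ffin n; rewrite -integral_mkcond; exact: fB.
have F_incl n m : (n <= m)%N -> F n `<=` F m by move=> /ndF/subsetPset.
have nd x : {homo (fun n => (f \_ (F n)) x) : n m / (n <= m)%N >-> n <= m}.
  move=> n m nm; rewrite !patchE; case: ifPn => [/set_mem/(F_incl _ _ nm) Fx|_].
    by rewrite mem_set.
  by case: ifPn.
have mfF n : measurable_fun [set: T] (f \_ (F n)).
  apply/(measurable_restrictT _ _).1; first exact: (Ffin n).1.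
  exact: measurable_funS mf.
have fF0 n x : [set: T] x -> 0 <= (f \_ (F n)) x.
  by move=> _; rewrite patchE; case: ifPn.
have cv := cvg_monotone_convergence (mu := mu) measurableT mfF fF0
  (fun x _ => nd x).
rewrite (eq_integral (fun x => limn (fun n => (f \_ (F n)) x))).
  by rewrite -(cvg_lim _ cv)//; apply: lime_le; [exact: cvgP cv|exact: nearW].
(* At each point the restrictions of [f] to [F n] are eventually constant, equal to [f x] once [x]
   has entered some [F n]. *)
move=> x _; apply/esym/cvg_lim => //.
have [n _ Fx] : (\bigcup_i F i) x by rewrite -TF.
apply: cvg_near_cst; exists n => // m /= nm.
by rewrite patchE mem_set//; exact: F_incl Fx.
Qed.

Theorem theorem3p28 (d : measure_display) (T : measurableType d) (R : realType)
    (mu : {sigma_finite_measure set T -> \bar R}) (K : R)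
    (K_gt0 : (0 < K)%R) (K_lt : K%:E < mu [set: T]) :
  [set s : Linfty mu | 'N[mu]_+oo[EFin \o s] <= 1 /\ L0_norm mu s <= K%:E]
    `<=` largest_K_subdifferential0 mu K
  /\
  largest_K_subdifferential0 mu K
    `<=` [set s : Linfty mu | 'N[mu]_+oo[EFin \o s] <= 1 /\
                              'N[mu]_1[EFin \o s] <= K%:E].
Proof.
(* The norm ['N[mu]_+oo] is defined by cases on the total measure and is the essential supremum when
   that measure is positive. *)
have muT_gt0 : 0 < mu [set: T] by apply: lt_trans K_lt; rewrite lte_fin.
have NyE (f : T -> R) :
    'N[mu]_+oo[EFin \o f] <= 1 <-> \forall x \ae mu, (`|f x| <= 1)%R.
  rewrite unlock /Lnorm muT_gt0; split => [/ess_supP|f1].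
    by apply: filterS => x; rewrite /= lee_fin.
  by apply/ess_supP; apply: filterS f1 => x; rewrite /= lee_fin.
split=> s /=; have ms := measurable_aeEqMfun s.
  move=> [/NyE s1 sK] v; have mv := measurable_aeEqMfun v.
  pose S := [set x | s x != 0%R].
  have mS : measurable S.
    rewrite (_ : S = s @^-1` (~` [set 0%R])); last first.
      by apply/seteqP; split=> x /eqP.
    by rewrite -[_ @^-1` _]setTI; apply: ms => //; exact: measurableC.
  have msv : measurable_fun [set: T] (fun x => (s x * v x)%:E).
    by apply/measurable_EFinP; exact: measurable_funM.
  have mav : measurable_fun [set: T] (fun x => `|v x|%:E).
    by apply/measurable_EFinP; exact: measurableT_comp.
  apply: (@le_trans _ _ (\int[mu]_(x in S) `|v x|%:E)); last first.
    by apply: ereal_sup_ubound; exists S.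
  (* With absolute values inside, both integrands are nonnegative, and it suffices to compare
     [|s v|] with [|v|] restricted to [S] almost everywhere: on [S] by [|s| <= 1], and off [S] both
     are 0. *)
  apply: le_trans (lee_abs _) _; apply: le_trans (le_abse_integral _ _ _) _ => //.
  rewrite [leRHS]integral_mkcond; apply: ae_ge0_le_integral => //.
  - exact: measurableT_comp.
  - by move=> x _; rewrite patchE; case: ifPn => //; rewrite lee_fin.
  - apply/(measurable_restrictT _ _).1 => //; exact: measurable_funS mav.
  - apply: filterS s1 => x s1 _; rewrite patchE; case: ifPn => [_|].
      by rewrite lee_fin normrM ler_piMl.
    by rewrite notin_setE => /negP; rewrite negbK => /eqP ->; rewrite mul0r abse0.
move=> sK; have mas : measurable_fun [set: T] (fun x => `|s x|%R).
  exact: measurableT_comp.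
have sfin := sigma_finiteT mu.
split.
  apply/NyE/(ae_le1_of_integral_le sfin mas) => B mB mBy.
  by have [] := subdifferential0_integral_le sK mB mBy.
rewrite Lnorm1; apply: (integral_le_of_sigma_finite sfin) => //.
  by do 2 apply: measurableT_comp => //.
move=> B mB mBy.
by have [] := subdifferential0_integral_le sK mB mBy.
Qed.
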